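(* Let $T>0$ be an integer and let $(\Sigma,\{\Theta_t\})$ be a discrete-time $T$-periodic dynamical system with $\Sigma\subseteq\mathbb{C}^n$. Then for every $\varepsilon>0$, every $m\in\mathbb{Z}$ with $2T\leq 2m\leq n$, and every $m$-system of history vectors $\mathbb{H}[\Sigma,m]=\{v_1,\ldots,v_m\}$ for $(\Sigma,\{\Theta_t\})$, the triple $(\Sigma,\{\Theta_t\},\mathbb{H}[\Sigma,m])$ is $(\mathbb{Z}/T,\varepsilon)$-controlled.
   Context: A discrete-time dynamical system $(\Sigma,\{\Theta_t\})$ consists of a set $\Sigma\subseteq\mathbb{C}^n$ and continuous maps $\Theta_t:\Sigma\to\Sigma$ with $\Theta_0=\mathrm{id}_\Sigma$ and $\Theta_t\circ\Theta_s=\Theta_{t+s}$ for all integers $t,s\ge 0$. It is $T$-periodic if $\Theta_{t+T}=\Theta_t$ for every integer $t\ge 0$. An $m$-system of history vectors for it is $\mathbb{H}[\Sigma,m]=\{v_1,\ldots,v_m\}\subseteq\Sigma$ with $v_{k+1}=\Theta_k(v_1)$ for $0\le k\le m-1$ (so $v_{k+1}=\Theta_1(v_k)$ for $1\le k\le m-1$). A projection is a matrix $P$ with $P=P^\ast=P^2$. $\mathbb{C}[\mathbb{Z}/r]$ is the complex group algebra of the additive cyclic group $\mathbb{Z}/r=\{\hat0,\hat1,\ldots,\widehat{r-1}\}$. A unitary representation $\rho_r:\mathbb{C}[\mathbb{Z}/r]\to\mathbb{C}^{r\times r}$ is an algebra homomorphism whose restriction to $\mathbb{Z}/r$ is a group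 representation by unitary matrices. Other algebra homomorphisms are linear and multiplicative, not necessarily unit-preserving. For a polynomial $f\in\mathbb{C}[z]$, $f(\hat1)\in\mathbb{C}[\mathbb{Z}/r]$ is the evaluation of $f$ at the element $\hat1$ in the algebra $\mathbb{C}[\mathbb{Z}/r]$. For an integer $r>0$ and $\varepsilon>0$, the triple $(\Sigma,\{\Theta_t\},\mathbb{H}[\Sigma,m])$ is $(\mathbb{Z}/r,\varepsilon)$-controlled if there are a unitary representation $\rho_r:\mathbb{C}[\mathbb{Z}/r]\to\mathbb{C}^{r\times r}$, an algebra homomorphism $\varphi:\mathbb{C}^{r\times r}\to\mathbb{C}^{n\times n}$, polynomial functions $(f_k)_{k\ge0}$, all belonging to the finite family $\{f_0,\ldots,f_{r-1}\}$, two projections $\hat K,\hat T\in\mathbb{C}^{n\times n}$, and a vector $\tilde v\in\mathbb{C}^n$ such that $$\|\Theta_k(v_1)-\hat K\,\varphi(\rho_r(f_k(\hat1)))\,\hat T\,\tilde v\|_2\le\varepsilon\quad\text{for every }k\ge0.$$ *)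

(* Defs.v *)
From HB Require Import structures.
From mathcomp Require Import all_boot all_order all_fingroup all_algebra.
From mathcomp Require Import spectral mxrepresentation complex.
From mathcomp Require Import all_classical all_reals all_analysis.

Set Implicit Arguments.
Unset Strict Implicit.
Unset Printing Implicit Defensive.

Import Order.TTheory GRing.Theory Num.Theory numFieldNormedType.Exports.

Local Open Scope complex_scope.
Local Open Scope classical_set_scope.
Local Open Scope sesquilinear_scope.
Local Open Scope ring_scope.

(* The usual topology of C, induced by the modulus; the topology of
   'cV[R[i]]_n is then the product topology. *)
HB.instance Definition _ (R : realType) := NormedModule.copy R[i] R[i]^o.

(* The group algebra R[gT]: a function x stands for the formal sum of the
   (x g) g, so that the product is the convolution. *)
Definition group_algebra (R : comNzRingType) (gT : finGroupType) : Type :=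
  {ffun gT -> R}.

Section GroupAlgebra.
Variables (R : comNzRingType) (gT : finGroupType).
Local Notation A := (group_algebra R gT).
Implicit Types (x y z : A) (g h : gT) (c : R).

HB.instance Definition _ := GRing.Zmodule.copy A {ffun gT -> R}.

Definition group_elt g : A := [ffun h => (h == g)%:R].

Definition galg_mul x y : A := [ffun g => \sum_h x h * y (h^-1 * g)%g].

Definition galg_scale c x : A := [ffun g => c * x g].

Lemma galg_addE x y g : (x + y) g = x g + y g.
Proof. by rewrite ffunE. Qed.

Lemma galg_mulA : associative galg_mul.
Proof.
move=> x y z; apply/ffunP => g; rewrite !ffunE.
under eq_bigr do rewrite ffunE mulr_sumr.
under [RHS]eq_bigr do rewrite ffunE mulr_suml.
rewrite [RHS]exchange_big /=; apply: eq_bigr => h _.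
rewrite (reindex_inj (mulgI h^-1%g)) /=; apply: eq_bigr => k _.
by rewrite invMg invgK -mulgA mulKVg mulrA.
Qed.

Lemma galg_mul1r : left_id (group_elt 1%g) galg_mul.
Proof.
move=> x; apply/ffunP => g; rewrite ffunE (bigD1 1%g) //= big1 => [|h h1].
  by rewrite ffunE eqxx mul1r invg1 mul1g addr0.
by rewrite ffunE (negPf h1) mul0r.
Qed.

Lemma galg_mulr1 : right_id (group_elt 1%g) galg_mul.
Proof.
move=> x; apply/ffunP => g; rewrite ffunE (bigD1 g) //= big1 => [|h hg].
  by rewrite ffunE mulVg eqxx mulr1 addr0.
by rewrite ffunE -eq_mulVg1 (negPf hg) mulr0.
Qed.

Lemma galg_mulDl : left_distributive galg_mul +%R.
Proof.
move=> x y z; apply/ffunP => g; rewrite !ffunE -big_split /=.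
by apply: eq_bigr => h _; rewrite galg_addE mulrDl.
Qed.

Lemma galg_mulDr : right_distributive galg_mul +%R.
Proof.
move=> x y z; apply/ffunP => g; rewrite !ffunE -big_split /=.
by apply: eq_bigr => h _; rewrite galg_addE mulrDr.
Qed.

Lemma galg_oner_neq0 : group_elt 1%g != 0 :> A.
Proof.
by apply/eqP => /ffunP/(_ 1%g)/eqP; rewrite !ffunE eqxx oner_eq0.
Qed.

HB.instance Definition _ := GRing.Zmodule_isNzRing.Build A
  galg_mulA galg_mul1r galg_mulr1 galg_mulDl galg_mulDr galg_oner_neq0.

Lemma galg_scaleA c d x : galg_scale c (galg_scale d x) = galg_scale (c * d) x.
Proof. by apply/ffunP => g; rewrite !ffunE mulrA. Qed.

Lemma galg_scale1 : left_id 1 galg_scale.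
Proof. by move=> x; apply/ffunP => g; rewrite !ffunE mul1r. Qed.

Lemma galg_scaleDr : right_distributive galg_scale +%R.
Proof. by move=> c x y; apply/ffunP => g; rewrite !ffunE mulrDr. Qed.

Lemma galg_scaleDl x : {morph galg_scale^~ x : c d / c + d}.
Proof. by move=> c d; apply/ffunP => g; rewrite !ffunE mulrDl. Qed.

HB.instance Definition _ := GRing.Zmodule_isLmodule.Build R A
  galg_scaleA galg_scale1 galg_scaleDr galg_scaleDl.

Lemma galg_scaleAl c x y : c *: (x * y) = (c *: x) * y.
Proof.
apply/ffunP => g; rewrite !ffunE mulr_sumr.
by apply: eq_bigr => h _; rewrite ffunE mulrA.
Qed.

HB.instance Definition _ := GRing.Lmodule_isLalgebra.Build R A galg_scaleAl.

Lemma galg_scaleAr c x y : c *: (x * y) = x * (c *: y).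
Proof.
apply/ffunP => g; rewrite !ffunE mulr_sumr.
by apply: eq_bigr => h _; rewrite ffunE mulrCA.
Qed.

HB.instance Definition _ := GRing.Lalgebra_isAlgebra.Build R A galg_scaleAr.

Lemma group_eltM g h : group_elt (g * h)%g = group_elt g * group_elt h.
Proof.
apply/ffunP => k; rewrite !ffunE (bigD1 g) //= big1 => [|l lg].
  by rewrite !ffunE eqxx mul1r addr0 -(inj_eq (mulgI g^-1%g)) mulKg.
by rewrite ffunE (negPf lg) mul0r.
Qed.

End GroupAlgebra.

(* Z/r for r > 0, as a finite group under addition. ('Z_r would be Z/2 for
   r = 1.) *)
Definition cyclic_group (r : nat) : finGroupType := 'I_r.-1.+1.

Section Control.
Variable R : realType.
Local Notation C := R[i].

Definition l2norm n (x : 'cV[C]_n) : R :=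
  Num.sqrt (\sum_(j < n) (complex.Re (x j 0) ^+ 2 + complex.Im (x j 0) ^+ 2)).

Definition is_projection n (P : 'M[C]_n) : Prop := P = P^t* /\ P = P *m P.

(* A self-map of the state set is the restriction of a total function, whose
   values outside of the state set are never used. *)
Record dynamical_system (n : nat) := DynamicalSystem {
  states : set 'cV[C]_n;
  flow : nat -> 'cV[C]_n -> 'cV[C]_n;
  flow_states : forall t, set_fun states states (flow t);
  flow_continuous : forall t, {within states, continuous (flow t)};
  flow0 : forall x, states x -> flow 0%N x = x;
  flowD : forall t s x, states x -> flow t (flow s x) = flow (t + s)%N x
}.

Definition is_periodic n (S : dynamical_system n) (T : nat) : Prop :=
  forall t x, states S x -> flow S (t + T)%N x = flow S t x.

(* v`_k is the vector v_{k+1}. *)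
Definition history_system n (S : dynamical_system n) m
    (v : m.-tuple 'cV[C]_n) : Prop :=
  forall k, (k < m)%N -> states S v`_k /\ v`_k = flow S k v`_0.

Definition unitary_representation (gT : finGroupType) d
    (rho : group_algebra C gT -> 'M[C]_d) : Prop :=
  [/\ linear rho,
      {morph rho : x y / x * y >-> x *m y},
      mx_repr [set: gT]%G (fun g => rho (group_elt C g)) &
      forall g : gT, rho (group_elt C g) \is unitarymx].

(* phi need not map the identity matrix to the identity matrix. *)
Definition algebra_hom d n (phi : 'M[C]_d -> 'M[C]_n) : Prop :=
  linear phi /\ {morph phi : X Y / X *m Y >-> X *m Y}.

(* Meaningful for r > 0, eps > 0 and m > 0. *)
Definition controlled n (S : dynamical_system n) m (v : m.-tuple 'cV[C]_n)
    (r : nat) (eps : R) : Prop :=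
  exists (rho : group_algebra C (cyclic_group r) -> 'M[C]_r)
         (phi : 'M[C]_r -> 'M[C]_n) (f : nat -> {poly C})
         (K T : 'M[C]_n) (w : 'cV[C]_n),
  [/\ unitary_representation rho /\ algebra_hom phi,
      forall k, exists2 j, (j < r)%N & f k = f j,
      is_projection K /\ is_projection T &
      forall k, l2norm (flow S k v`_0 -
        K *m phi (rho (horner_alg (group_elt C (inZp 1 : cyclic_group r))
                                  (f k)))
          *m T *m w) <= eps].

End Control.

(* Main.v *)
(* The vectors are reproduced exactly. Let V be the n x T matrix with columns
   Theta_0(v_1), ..., Theta_{T-1}(v_1). Since 2T <= n, the left kernel of V
   contains T orthonormal rows, which form a matrix W with W W^* = 1 and
   W V = 0. Then A = V + W^* satisfies W A = 1, so that phi(X) = A X W is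
   multiplicative, and the projection K = 1 - W^* W satisfies K A = V. For the
   regular representation rho of Z/T, rho(1)^k e_0 = e_{k mod T}; with
   f_k = X^(k mod T) and w = W^* e_0 this gives
   K phi(rho(f_k(1))) w = V e_{k mod T}. *)
Require Import Defs.
From mathcomp Require Import all_boot all_order all_fingroup all_algebra.
From mathcomp Require Import spectral mxrepresentation complex.
From mathcomp Require Import all_classical all_reals all_analysis.

Import Order.TTheory GRing.Theory Num.Theory.

Local Open Scope complex_scope.
Local Open Scope sesquilinear_scope.
Local Open Scope ring_scope.

(** The left kernel of [V] has dimension at least n - p, hence at least q. Gram-Schmidt keeps the
    row space of a basis of it, and any q of the resulting orthonormal rows will do. *)
Lemma exists_unitarymx_annihilator (C : numClosedFieldType) (n p q : nat)
    (V : 'M[C]_(n, p)) :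
  (p + q <= n)%N -> exists2 W : 'M[C]_(q, n), W \is unitarymx & W *m V = 0.
Proof.
move=> le_pq_n.
have le_q : (q <= \rank (kermx V))%N.
  rewrite mxrank_ker leq_subRL ?rank_leq_row //.
  by apply: leq_trans le_pq_n; rewrite leq_add2r rank_leq_col.
set B := row_base (kermx V).
have BV : schmidt B *m V = 0.
  apply/sub_kermxP.
  rewrite eqmx_schmidt_free ?eq_row_base //.
  exact: row_base_free.
have uB : schmidt B \is unitarymx.
  by apply: schmidt_unitarymx; rewrite rank_leq_col.
exists (rowsub (widen_ord le_q) (schmidt B)); last first.
  by rewrite mul_rowsub_mx BV; apply/matrixP => i j; rewrite !mxE.
apply/row_unitarymxP => i j; rewrite !row_rowsub (row_unitarymxP uB).
by congr (_%:R).
Qed.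

Section RegularRepresentation.
Variables (R : realType) (p : nat).
Local Notation C := R[i].
Local Notation gT := (cyclic_group p.+1).

(** Left multiplication by [x] in the basis of group elements: the coefficient of x j at i is x(i
    j^-1). *)
Definition regular_rep (x : group_algebra C gT) : 'M[C]_p.+1 :=
  \matrix_(i, j) x ((i : gT) * (j : gT)^-1)%g.

Lemma regular_rep_elt1 : regular_rep (group_elt C 1%g) = 1%:M.
Proof. by apply/matrixP => i j; rewrite !mxE ffunE -eq_mulgV1. Qed.

Lemma regular_repM : {morph regular_rep : x y / x * y >-> x *m y}.
Proof.
move=> x y; apply/matrixP => i j; rewrite !mxE ffunE.
(* Substituting h = i k^-1 turns the convolution sum into the sum over the inner index of the matrix
   product. *)
rewrite (reindex_inj (h := fun k : gT => ((i : gT) * k^-1)%g)) /=; last first.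
  by move=> k l /mulgI /invg_inj.
by apply: eq_bigr => k _; rewrite !mxE invMg invgK -mulgA mulKg.
Qed.

Lemma regular_rep_unitary : unitary_representation regular_rep.
Proof.
split.
- by move=> c x y; apply/matrixP => i j; rewrite !mxE !ffunE.
- exact: regular_repM.
- split=> [|g h _ _]; first exact: regular_rep_elt1.
  by rewrite group_eltM regular_repM.
- move=> g; apply/unitarymxP.
  (* The entries are 0 or 1, so conjugation fixes them, and j i^-1 = g exactly when i j^-1 =
     g^-1. *)
  have -> : (regular_rep (group_elt C g))^t* = regular_rep (group_elt C g^-1%g).
    apply/matrixP => i j; rewrite !mxE !ffunE rmorph_nat.
    by rewrite -(inj_eq (@invg_inj gT)) invMg invgK.
  by rewrite -regular_repM -group_eltM mulgV regular_rep_elt1.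
Qed.

Lemma horner_generator_Xn k :
  horner_alg (group_elt C (inZp 1 : gT)) 'X^k = group_elt C (inZp k : gT).
Proof.
rewrite rmorphXn /= horner_algX; elim: k => [|k IHk].
  by rewrite expr0; congr group_elt; apply/val_inj; rewrite /= mod0n.
rewrite exprS IHk -group_eltM; congr group_elt.
by apply/val_inj; rewrite /= modnDm add1n.
Qed.

Lemma regular_rep_delta0 (g : gT) :
  regular_rep (group_elt C g) *m delta_mx 0 0 = delta_mx g 0 :> 'cV_p.+1.
Proof.
rewrite -colE; apply/matrixP => i j.
(* The group law is addition, so its identity is the index 0. *)
have -> : (0 : 'I_p.+1) = (1%g : gT) by [].
by rewrite !mxE ffunE invg1 mulg1 ord1 eqxx andbT.
Qed.

End RegularRepresentation.

(** The inner factor [B *m A] cancels in (A X B)(A Y B). *)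
Lemma algebra_hom_compression (R : realType) (d n : nat)
    (A : 'M[R[i]]_(n, d)) (B : 'M[R[i]]_(d, n)) :
  B *m A = 1%:M -> algebra_hom (fun X => A *m X *m B).
Proof.
move=> BA; split=> [c X Y|X Y].
  by rewrite mulmxDr mulmxDl -scalemxAr -scalemxAl.
by rewrite !mulmxA -[A *m X *m B *m A]mulmxA BA mulmx1.
Qed.

Lemma flow_modn (R : realType) (n T : nat) (S : dynamical_system R n) :
  is_periodic S T ->
  forall k x, states S x -> flow S (k %% T)%N x = flow S k x.
Proof.
move=> perS k x Sx; rewrite [in RHS](divn_eq k T) addnC.
elim: (k %/ T)%N => [|q IHq]; first by rewrite addn0.
by rewrite mulSnr addnA perS.
Qed.

Lemma projection_unitary_compl (R : realType) (d n : nat)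
    (W : 'M[R[i]]_(d, n)) :
  W \is unitarymx -> is_projection (1%:M - W^t* *m W).
Proof.
move=> /unitarymxP WW; split.
  rewrite linearB /= trmx1 rmorphB /=.
  by rewrite map_mx1 trmx_mul map_mxM /= trmxCK.
rewrite mulmxBr mulmx1 mulmxBl mul1mx !mulmxA.
by rewrite -[W^t* *m W *m W^t*]mulmxA WW mulmx1 subrr subr0.
Qed.

Theorem theorem3p3 (R : realType) (n T : nat) (S : dynamical_system R n)
    (hT : (0 < T)%N) (hS : is_periodic S T)
    (eps : R) (heps : 0 < eps)
    (m : nat) (hTm : (2 * T <= 2 * m)%N) (hmn : (2 * m <= n)%N)
    (v : m.-tuple 'cV[R[i]]_n) (hv : history_system S v) :
  controlled S v T eps.
Proof.
case: T hT hS hTm => // p _ perS le_pm.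
have Sv0 : states S v`_0.
  by case: (hv 0%N) => //; rewrite -(ltn_pmul2l (isT : 0 < 2)%N) (leq_trans _ le_pm).
pose V : 'M[R[i]]_(n, p.+1) := \matrix_(i, j) flow S j v`_0 i 0.
have [|W uW WV] := @exists_unitarymx_annihilator _ _ _ p.+1 V.
  by rewrite addnn -mul2n (leq_trans le_pm).
have /unitarymxP WW := uW.
have WA : W *m (V + W^t*) = 1%:M by rewrite mulmxDr WV add0r.
have KA : (1%:M - W^t* *m W) *m (V + W^t*) = V.
  by rewrite mulmxBl mul1mx -mulmxA WA mulmx1 addrK.
exists (@regular_rep R p), (fun X => (V + W^t*) *m X *m W),
  (fun k => 'X^(k %% p.+1)), (1%:M - W^t* *m W), 1%:M, (W^t* *m delta_mx 0 0).
split.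
- split; [exact: regular_rep_unitary | exact: algebra_hom_compression].
- by move=> k; exists (k %% p.+1)%N; rewrite ?ltn_mod ?modn_mod.
- split; first exact: projection_unitary_compl.
  by split; rewrite ?mulmx1 // trmx1 map_mx1.
move=> k; rewrite horner_generator_Xn mulmx1 !mulmxA KA.
(* The W of phi meets the W^* of the vector and cancels; what remains is column k mod T of [V]. *)
rewrite -[X in X *m delta_mx _ _]mulmxA WW mulmx1 -mulmxA regular_rep_delta0.
rewrite -colE -(flow_modn _ _ _ _ perS) //.
have -> : col (inZp (k %% p.+1)) V = flow S (k %% p.+1)%N v`_0.
  by apply/matrixP => i j; rewrite !mxE /= modn_mod ord1.
rewrite subrr /l2norm big1 ?sqrtr0 ?ltW // => i _.
by rewrite !mxE /= expr0n addr0.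
Qed.
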